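(* For every game structure $G$ and all states $s,t$ of $G$: $$[s\preceq_1 t]=\sup_{\varphi\in\mathrm{q}\mu_1^+}\big([\![\varphi]\!](s)-[\![\varphi]\!](t)\big),\qquad [s\simeq_g t]=\sup_{\varphi\in\mathrm{q}\mu}|[\![\varphi]\!](s)-[\![\varphi]\!](t)|.$$
   Context: A game structure $G=(S,[\cdot],\mathit{Moves},\Gamma_1,\Gamma_2,\delta)$: finite state set $S$; finite set $V$ of observation variables, each $v$ interpreted as $[v]:S\to[0,1]$; finite move set; $\Gamma_1,\Gamma_2:S\to2^{\mathit{Moves}}\setminus\{\emptyset\}$; $\delta:S\times\mathit{Moves}\times\mathit{Moves}\to\mathrm{Distr}(S)$. $\bar i=3-i$. Mixed moves $\mathcal{D}_i(s)=\mathrm{Distr}(\Gamma_i(s))$; $\delta(s,x_1,x_2)(u)=\sum_{a_1,a_2}\delta(s,a_1,a_2)(u)x_1(a_1)x_2(a_2)$. Valuations $k:S\to[0,1]$; $\mathrm{E}^{x_1,x_2}_s(k)=\sum_u\delta(s,x_1,x_2)(u)k(u)$; $\mathrm{Pre}_i(k)(s)=\sup_{x_i\in\mathcal{D}_i(s)}\inf_{x_{\bar i}\in\mathcal{D}_{\bar i}(s)}\mathrm{E}^{x_1,x_2}_s(k)$. Metrics: directed metrics $d:S\times S\to\mathbb{R}_{\ge0}$ ($d(s,s)=0$, triangle inequality), ordered pointwise; $\breve d(s,t)=d(t,s)$; $\sqcup=\max$; $C(d)=\{k:k(s)-k(t)\le d(s,t)\ \forall s,t\}$; $[s\equiv t]=\max_v|[v](s)-[v](t)|$;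 $H_{\preceq_i}(d)(s,t)=[s\equiv t]\sqcup\sup_{k\in C(d)}(\mathrm{Pre}_i(k)(s)-\mathrm{Pre}_i(k)(t))$. $[\preceq_1]$ (a priori simulation metric) is the least fixpoint of $H_{\preceq_1}$; $[\simeq_i]$ is the least fixpoint of $d\mapsto H_{\preceq_i}(d)\sqcup\breve{H_{\preceq_i}(d)}$; $[\simeq_1]=[\simeq_2]$ and this a priori bisimulation metric is denoted $[\simeq_g]$. Quantitative $\mu$-calculus: formulas $\varphi::=c\mid v\mid Z\mid\neg\varphi\mid\varphi\vee\varphi\mid\varphi\wedge\varphi\mid\varphi\oplus c\mid\varphi\ominus c\mid\mathrm{pre}_1(\varphi)\mid\mathrm{pre}_2(\varphi)\mid\mu Z.\varphi\mid\nu Z.\varphi$ ($c\in[0,1]$, $v\in V$, $Z$ calculus variables), bound variables occurring under an even number of negations. Semantics under environment $\xi$: constants, $[\![v]\!]=[v]$, $[\![Z]\!]=\xi(Z)$, $[\![\neg\varphi]\!]=1-[\![\varphi]\!]$, $\vee/\wedge$ = pointwise max/min, $[\![\varphi\oplus c]\!]=\min\{1,\max\{0,[\![\varphi]\!]+c\}\}$, $[\![\varphi\ominus c]\!]=\max\{0,\min\{1,[\![\varphi]\!]-c\}\}$, $[\![\mathrm{pre}_i\varphi]\!]=\mathrm{Pre}_i([\![\varphi]\!])$, $\mu/\nu$ = least/greatest valuation $f$ with $f=[\![\varphi]\!]_{\xi[Z\mapsto f]}$. $\mathrm{q}\mu$ = closed formulas; $\mathrm{q}\mu_1^+$ = closed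 formulas without $\mathrm{pre}_2$ and with $\neg$ only directly before observation variables. *)

(* Defs.v *)
From HB Require Import structures.
From mathcomp Require Import all_boot all_order all_algebra.
From mathcomp Require Import boolp classical_sets reals.

Set Implicit Arguments.
Unset Strict Implicit.
Unset Printing Implicit Defensive.

Import Order.TTheory GRing.Theory Num.Theory.

Local Open Scope classical_set_scope.
Local Open Scope ring_scope.

Variant player := P1 | P2.

Definition opponent (i : player) : player := if i is P1 then P2 else P1.

Section Distributions.
Variables (R : realType) (T : finType).

Definition is_distr (p : T -> R) : Prop :=
  (forall x, 0 <= p x) /\ \sum_x p x = 1.

(* Distr(A) for a subset A of T: distributions on T with support in A. *)
Definition distr_on (A : {set T}) : set (T -> R) :=
  [set p | is_distr p /\ forall x, x \notin A -> p x = 0].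

End Distributions.

Record game (R : realType) := Game {
  state : finType;
  obsvar : finType;
  move : finType;
  obs : obsvar -> state -> R;
  obs01 : forall v s, 0 <= obs v s <= 1;
  avail : player -> state -> {set move};
  avail_neq0 : forall i s, avail i s != finset.set0;
  trans : state -> move -> move -> state -> R;
  trans_distr : forall s a1 a2, is_distr (trans s a1 a2)
}.

Section LeastFixpoint.
Variables (T : choiceType) (D : set T) (le : T -> T -> Prop) (F : T -> T).

Definition is_least_fixpoint (x : T) : Prop :=
  [/\ D x, F x = x & forall y, D y -> F y = y -> le x y].

(* The least fixpoint of F in (D, le); x0 is a junk value, returned only when
   there is no least fixpoint. *)
Definition least_fixpoint (x0 : T) : T := xget x0 [set x | is_least_fixpoint x].

End LeastFixpoint.

Section Games.
Variables (R : realType) (G : game R).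

Local Notation S := (state G).
Local Notation M := (move G).
Local Notation V := (obsvar G).

Definition mixed (i : player) (s : S) : set (M -> R) := distr_on (avail i s).

Definition mtrans (s : S) (x1 x2 : M -> R) (u : S) : R :=
  \sum_(a1 in avail P1 s) \sum_(a2 in avail P2 s) trans s a1 a2 u * x1 a1 * x2 a2.

Definition expect (s : S) (x1 x2 : M -> R) (k : S -> R) : R :=
  \sum_u mtrans s x1 x2 u * k u.

(* Expected value when player i plays x and the opponent of i plays y. *)
Definition expect_for (i : player) (s : S) (x y : M -> R) (k : S -> R) : R :=
  if i is P1 then expect s x y k else expect s y x k.

Definition Pre (i : player) (k : S -> R) (s : S) : R :=
  sup [set inf [set expect_for i s x y k | y in mixed (opponent i) s]
      | x in mixed i s].

Definition valuation : set (S -> R) := [set k | forall s, 0 <= k s <= 1].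

Definition val_le (f g : S -> R) : Prop := forall s, f s <= g s.

Definition directed_metric : set (S -> S -> R) :=
  [set d | [/\ forall s t, 0 <= d s t,
               forall s, d s s = 0 &
               forall s t u, d s u <= d s t + d t u]].

Definition metric_le (d e : S -> S -> R) : Prop := forall s t, d s t <= e s t.

Definition converse (d : S -> S -> R) : S -> S -> R := fun s t => d t s.

Definition metric_max (d e : S -> S -> R) : S -> S -> R :=
  fun s t => Num.max (d s t) (e s t).

Definition C (d : S -> S -> R) : set (S -> R) :=
  [set k | valuation k /\ forall s t, k s - k t <= d s t].

Definition obs_dist (s t : S) : R :=
  \big[Num.max/0]_(v : V) `|obs v s - obs v t|.

Definition Hsim (i : player) (d : S -> S -> R) : S -> S -> R :=
  fun s t => Num.max (obs_dist s t) (sup [set Pre i k s - Pre i k t | k in C d]).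

Definition Hbisim (i : player) (d : S -> S -> R) : S -> S -> R :=
  metric_max (Hsim i d) (converse (Hsim i d)).

Definition sim_metric (i : player) : S -> S -> R :=
  least_fixpoint directed_metric metric_le (Hsim i) (fun _ _ => 0).

Definition bisim_metric (i : player) : S -> S -> R :=
  least_fixpoint directed_metric metric_le (Hbisim i) (fun _ _ => 0).

(* The bisimulation metrics of the two players coincide; player 1's is taken
   as the definition of the common value. *)
Definition game_bisim_metric : S -> S -> R := bisim_metric P1.

Inductive formula : Type :=
  | FConst of R
  | FObs of V
  | FVar of nat
  | FNeg of formula
  | FOr of formula & formula
  | FAnd of formula & formula
  | FPlus of formula & R
  | FMinus of formula & R
  | FPre of player & formula
  | FMu of nat & formula
  | FNu of nat & formula.

Fixpoint free_vars (phi : formula) : seq nat :=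
  match phi with
  | FConst _ | FObs _ => [::]
  | FVar Z => [:: Z]
  | FOr p q | FAnd p q => free_vars p ++ free_vars q
  | FNeg p | FPlus p _ | FMinus p _ | FPre _ p => free_vars p
  | FMu Z p | FNu Z p => [seq Y <- free_vars p | Y != Z]
  end.

Definition closed (phi : formula) : bool := nilp (free_vars phi).

(* Z has a free occurrence in phi lying under a number of negations of parity
   b (b = true for odd). *)
Fixpoint occurs (Z : nat) (b : bool) (phi : formula) : bool :=
  match phi with
  | FConst _ | FObs _ => false
  | FVar Y => (Y == Z) && ~~ b
  | FNeg p => occurs Z (~~ b) p
  | FOr p q | FAnd p q => occurs Z b p || occurs Z b q
  | FPlus p _ | FMinus p _ | FPre _ p => occurs Z b p
  | FMu Y p | FNu Y p => (Y != Z) && occurs Z b p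
  end.

Fixpoint well_formed (phi : formula) : bool :=
  match phi with
  | FConst c => 0 <= c <= 1
  | FObs _ | FVar _ => true
  | FNeg p | FPre _ p => well_formed p
  | FOr p q | FAnd p q => well_formed p && well_formed q
  | FPlus p c | FMinus p c => well_formed p && (0 <= c <= 1)
  | FMu Z p | FNu Z p => well_formed p && ~~ occurs Z true p
  end.

Fixpoint positive1 (phi : formula) : bool :=
  match phi with
  | FConst _ | FObs _ | FVar _ => true
  | FNeg (FObs _) => true
  | FNeg _ => false
  | FOr p q | FAnd p q => positive1 p && positive1 q
  | FPlus p _ | FMinus p _ => positive1 p
  | FPre P1 p => positive1 p
  | FPre P2 _ => false
  | FMu _ p | FNu _ p => positive1 p
  end.

Definition qmu : set formula := [set phi | well_formed phi /\ closed phi].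

Definition qmu1_pos : set formula := [set phi | qmu phi /\ positive1 phi].

Definition env := nat -> S -> R.

Definition update (xi : env) (Z : nat) (f : S -> R) : env :=
  fun Y => if Y == Z then f else xi Y.

Fixpoint sem (phi : formula) (xi : env) : S -> R :=
  match phi with
  | FConst c => fun _ => c
  | FObs v => obs v
  | FVar Z => xi Z
  | FNeg p => fun s => 1 - sem p xi s
  | FOr p q => fun s => Num.max (sem p xi s) (sem q xi s)
  | FAnd p q => fun s => Num.min (sem p xi s) (sem q xi s)
  | FPlus p c => fun s => Num.min 1 (Num.max 0 (sem p xi s + c))
  | FMinus p c => fun s => Num.max 0 (Num.min 1 (sem p xi s - c))
  | FPre i p => Pre i (sem p xi)
  | FMu Z p =>
      least_fixpoint valuation val_le
        (fun f => sem p (update xi Z f)) (fun _ => 0)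
  | FNu Z p =>
      least_fixpoint valuation (fun f g => val_le g f)
        (fun f => sem p (update xi Z f)) (fun _ => 0)
  end.

Lemma eq_sem_free (phi : formula) (xi xi' : env) :
  (forall Z, Z \in free_vars phi -> xi Z = xi' Z) -> sem phi xi = sem phi xi'.
Proof.
elim: phi xi xi' => //=.
- by move=> Z xi xi' ->; rewrite ?mem_head.
- by move=> p IH xi xi' e; rewrite (IH _ _ e).
- move=> p IHp q IHq xi xi' e.
  by rewrite (IHp xi xi') ?(IHq xi xi')// => Z ZP; apply: e; rewrite mem_cat ZP ?orbT.
- move=> p IHp q IHq xi xi' e.
  by rewrite (IHp xi xi') ?(IHq xi xi')// => Z ZP; apply: e; rewrite mem_cat ZP ?orbT.
- by move=> p IH c xi xi' e; rewrite (IH _ _ e).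
- by move=> p IH c xi xi' e; rewrite (IH _ _ e).
- by move=> i p IH xi xi' e; rewrite (IH _ _ e).
- move=> Z p IH xi xi' e; congr (least_fixpoint _ _ _ _); apply/funext => f.
  apply: IH => Y YP; rewrite /update; case: (eqVneq Y Z) => // YZ.
  by apply: e; rewrite mem_filter YZ.
- move=> Z p IH xi xi' e; congr (least_fixpoint _ _ _ _); apply/funext => f.
  apply: IH => Y YP; rewrite /update; case: (eqVneq Y Z) => // YZ.
  by apply: e; rewrite mem_filter YZ.
Qed.

(* A closed formula has the same value in all environments. *)
Definition den (phi : formula) : S -> R := sem phi (fun _ _ => 0).

Lemma denE (phi : formula) (xi : env) : closed phi -> sem phi xi = den phi.
Proof. by move=> /nilP cphi; apply: eq_sem_free => Z; rewrite cphi. Qed.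

End Games.

(* Main.v *)
(** The logical distance [L s t], the supremum of [den phi s - den phi t] over
    the formulas of the logic, is itself the least fixpoint of the metric
    transformer [H].

    - Every non-negative [d] with [H d <= d] (and, for the full logic, [d]
      symmetric) is above [L]: all formulas of the logic denote elements of
      [C d].  For [mu] and [nu] this holds because [C d] is closed under
      pointwise suprema and infima, so that Knaster-Tarski can be run inside
      it.  For [pre_2] it rests on [Pre_2 k = 1 - Pre_1 (1 - k)], that is, on
      the minimax theorem.
    - [H L <= L]: a valuation in [C L] is a uniform limit of formulas of the
      form max_u min_v phi_uv, and [Pre] is nonexpansive.
    - Hence [H L] is again a pre-fixpoint, so [L <= H L] by the first point.

    The minimax theorem is only needed up to an arbitrary [e > 0], which avoids
    compactness: the sum of squared excesses over the value has infimum 0. *)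

Require Import Defs.
From mathcomp Require Import all_boot all_order all_algebra.
From mathcomp Require Import boolp classical_sets reals.
From mathcomp Require Import ring lra.

Set Implicit Arguments.
Unset Strict Implicit.
Unset Printing Implicit Defensive.

Import Order.TTheory GRing.Theory Num.Theory.

Local Open Scope classical_set_scope.
Local Open Scope ring_scope.

(** * Approximate minimax theorem *)

Lemma distr_on_neq0 (R : realType) (T : finType) (B : {set T}) :
  B != finset.set0 -> @distr_on R T B !=set0.
Proof.
case/set0Pn => b bB; exists (fun x => (x == b)%:R); split; first split.
- by move=> x; rewrite ler0n.
- by rewrite (bigD1 b)//= eqxx big1 ?addr0// => x /negbTE ->.
- by move=> x; case: eqVneq => // ->; rewrite bB.
Qed.

Lemma sum_distr_on (R : realType) (T : finType) (B : {set T}) (p : T -> R) :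
  distr_on B p -> \sum_(x in B) p x = 1.
Proof.
move=> [[_ <-] p0].
by rewrite [RHS](bigID (mem B))/= [X in _ = _ + X]big1 ?addr0.
Qed.

Lemma distr_on_le1 (R : realType) (T : finType) (B : {set T}) (p : T -> R) x :
  distr_on B p -> 0 <= p x <= 1.
Proof.
move=> [[p0 <-] _]; rewrite p0/= (bigD1 x)//= lerDl.
by apply: sumr_ge0 => *.
Qed.

Lemma distr_on_mix (R : realType) (T : finType) (B : {set T}) (p q : T -> R) t :
  0 <= t <= 1 -> distr_on B p -> distr_on B q ->
  distr_on B (fun x => p x + t * (q x - p x)).
Proof.
move=> /andP[t0 t1] [[p0 p1] pB] [[q0 q1] qB]; split; first split.
- move=> x; rewrite (_ : _ + _ = (1 - t) * p x + t * q x); last by ring.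
  by rewrite addr_ge0// mulr_ge0// subr_ge0.
- by rewrite big_split/= -mulr_sumr sumrB p1 q1 subrr mulr0 addr0.
- by move=> x xB; rewrite pB// qB// subrr mulr0 addr0.
Qed.

Section Minimax.
Variables (R : realType) (T1 T2 : finType) (A : T1 -> T2 -> R).
Variables (B1 : {set T1}) (B2 : {set T2}).

Definition row_payoff (y : T2 -> R) (a : T1) : R := \sum_(b in B2) A a b * y b.

Definition payoff (x : T1 -> R) (y : T2 -> R) : R :=
  \sum_(a in B1) row_payoff y a * x a.

Definition excess (v : R) (y : T2 -> R) (a : T1) : R :=
  Num.max 0 (row_payoff y a - v).

(** It vanishes exactly when [y] holds every row of [B1] to at most [v]. The squares make its change
    under mixing linear plus quadratic in the step. *)
Definition potential (v : R) (y : T2 -> R) : R :=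
  \sum_(a in B1) excess v y a ^+ 2.

Lemma row_payoff_mix (y z : T2 -> R) t a :
  row_payoff (fun b => y b + t * (z b - y b)) a
  = row_payoff y a + t * (row_payoff z a - row_payoff y a).
Proof.
rewrite /row_payoff -sumrB mulr_sumr -big_split/=.
by apply: eq_bigr => b _; ring.
Qed.

(** Probabilities differ by at most 1. The bound does not depend on [y] and [z], so the quadratic
    loss of a descent step is uniform. *)
Lemma row_payoff_dist (y z : T2 -> R) a : distr_on B2 y -> distr_on B2 z ->
  (row_payoff z a - row_payoff y a) ^+ 2 <= (\sum_(b in B2) `|A a b|) ^+ 2.
Proof.
move=> yP zP; rewrite -[X in X <= _]real_normK ?num_real//.
have le_sum : `|row_payoff z a - row_payoff y a| <= \sum_(b in B2) `|A a b|.
  rewrite -sumrB (le_trans (ler_norm_sum _ _ _))// ler_sum// => b _.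
  rewrite -mulrBr normrM ler_piMr// ler_norml.
  have /andP[y0 y1] := distr_on_le1 b yP.
  have /andP[z0 z1] := distr_on_le1 b zP.
  by apply/andP; split; lra.
by rewrite lerXn2r ?nnegrE// (le_trans _ le_sum).
Qed.

(** If the left positive part is 0, any square dominates it; otherwise the bases are ordered and
    both positive. *)
Lemma excess_mix_sqr (r v e : R) :
  Num.max 0 (r + e - v) ^+ 2 <= (Num.max 0 (r - v) + e) ^+ 2.
Proof.
have [h|h] := leP (r + e - v) 0; first by rewrite expr0n/= sqr_ge0.
have h' : r + e - v <= Num.max 0 (r - v) + e.
  by rewrite addrAC lerD2r le_max lexx orbT.
by rewrite lerXn2r ?nnegrE// ltW//; apply: lt_le_trans h'.
Qed.

(** Normalised excesses form a mixed move [x]. A reply [z] to [x] makes the excess-weighted sum of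
    [row_payoff z a - v] at most 0, while the same sum for [y] is the potential. Moving [y] towards
    [z] thus has first-order change at most [- 2 * t * potential v y]. *)
Lemma potential_descent v (y : T2 -> R) t : 0 <= t <= 1 ->
  (forall x, distr_on B1 x -> exists2 z, distr_on B2 z & payoff x z <= v) ->
  distr_on B2 y ->
  exists2 z, distr_on B2 z & potential v z <=
    potential v y - 2 * t * potential v y
    + t ^+ 2 * \sum_(a in B1) (\sum_(b in B2) `|A a b|) ^+ 2.
Proof.
move=> t01 respond yP.
have bound_ge0 : 0 <= \sum_(a in B1) (\sum_(b in B2) `|A a b|) ^+ 2.
  by apply: sumr_ge0 => a _; exact: sqr_ge0.
have r_ge0 a : 0 <= excess v y a by rewrite /excess le_max lexx.
pose r := \sum_(a in B1) excess v y a.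
have : 0 <= r by apply: sumr_ge0 => a _.
(* With total excess 0 there is nothing to normalise, but then the potential is already 0 and [y]
   itself serves. *)
rewrite le_eqVlt => /predU1P[r0|r_gt0].
  exists y => //.
  suff -> : potential v y = 0 by rewrite mulr0 subrr add0r mulr_ge0 ?sqr_ge0.
  apply: big1 => a aB.
  suff -> : excess v y a = 0 by rewrite expr0n.
  apply/eqP; rewrite eq_le r_ge0 andbT r0 /r (bigD1 a)//= lerDl.
  exact: sumr_ge0.
pose x a := if a \in B1 then excess v y a / r else 0.
have xP : distr_on B1 x.
  split; first split.
  - by move=> a; rewrite /x; case: ifP => // _; rewrite divr_ge0// ltW.
  - by rewrite -big_mkcond/= -mulr_suml divff// gt_eqF.
  - by move=> a /negbTE aB; rewrite /x aB.
have [z zP zv] := respond x xP.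
exists (fun b => y b + t * (z b - y b)); first exact: distr_on_mix.
pose e a := row_payoff z a - row_payoff y a.
have le1 : potential v (fun b => y b + t * (z b - y b)) <=
    \sum_(a in B1) (excess v y a + t * e a) ^+ 2.
  by apply: ler_sum => a _; rewrite /excess row_payoff_mix excess_mix_sqr.
apply: (le_trans le1).
have -> : \sum_(a in B1) (excess v y a + t * e a) ^+ 2 =
    potential v y + 2 * t * (\sum_(a in B1) excess v y a * e a)
    + t ^+ 2 * (\sum_(a in B1) e a ^+ 2).
  rewrite !mulr_sumr -!big_split/=; apply: eq_bigr => a _; ring.
have /andP[t0 t1] := t01.
have le2 : \sum_(a in B1) e a ^+ 2 <=
    \sum_(a in B1) (\sum_(b in B2) `|A a b|) ^+ 2.
  by apply: ler_sum => a _; exact: row_payoff_dist.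
have le3 : \sum_(a in B1) excess v y a * e a <= - potential v y.
  have sz : \sum_(a in B1) excess v y a * (row_payoff z a - v) <= 0.
    have -> : \sum_(a in B1) excess v y a * (row_payoff z a - v) =
        r * (payoff x z - v).
      rewrite mulrBr [r * v]mulr_suml /payoff mulr_sumr -sumrB.
      apply: eq_bigr => a aB; rewrite /x aB.
      by field; rewrite gt_eqF.
    by rewrite pmulr_rle0// subr_le0.
  have sy : \sum_(a in B1) excess v y a * (row_payoff y a - v) = potential v y.
    apply: eq_bigr => a _; rewrite /excess.
    by case: leP => // _; rewrite ?mul0r ?expr0n// expr2.
  rewrite -sy.
  have -> : \sum_(a in B1) excess v y a * e a =
      \sum_(a in B1) excess v y a * (row_payoff z a - v)
      - \sum_(a in B1) excess v y a * (row_payoff y a - v).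
    by rewrite -sumrB; apply: eq_bigr => a _; rewrite /e; ring.
  lra.
rewrite lerD//; last by rewrite ler_wpM2l ?sqr_ge0.
by rewrite lerD2l// -mulrN ler_wpM2l// mulr_ge0.
Qed.

(* The infimum of the potential is 0: descending with step t from a
   near-minimiser would otherwise beat it, as the gain is linear in t and the
   loss quadratic. *)
Lemma potential_small v e : 0 < e -> B2 != finset.set0 ->
  (forall x, distr_on B1 x -> exists2 y, distr_on B2 y & payoff x y <= v) ->
  exists2 y, distr_on B2 y & potential v y < e.
Proof.
move=> e0 B20 respond; apply: contrapT => no_small.
pose P := [set potential v y | y in @distr_on R T2 B2].
have P0 : P !=set0.
  by have [y yP] := @distr_on_neq0 R _ _ B20; exists (potential v y), y.
have ge_e y : distr_on B2 y -> e <= potential v y.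
  by move=> yP; rewrite leNgt; apply/negP => ?; apply: no_small; exists y.
have lbP : has_lbound P by exists e => _ [y yP <-]; exact: ge_e.
set q := inf P.
have q_e : e <= q by apply: lb_le_inf => // _ [y yP <-]; exact: ge_e.
set N := \sum_(a in B1) (\sum_(b in B2) `|A a b|) ^+ 2.
have N0 : 0 <= N by apply: sumr_ge0 => a _; exact: sqr_ge0.
have q0 : 0 < q by exact: lt_le_trans q_e.
(* Chosen so that [t ^+ 2 * (q + N) = t * q]: from a potential below [q + t ^+ 2 * q], one descent
   step ends below [q - t * q], which is less than the infimum [q]. *)
pose t := q / (q + N).
have qN : 0 < q + N by rewrite ltr_pwDl.
have t0 : 0 < t by rewrite divr_gt0.
have t1 : t <= 1 by rewrite ler_pdivrMr// mul1r lerDl.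
have tN : t * (q + N) = q by rewrite /t divfK// gt_eqF.
have d0 : 0 < t ^+ 2 * q by rewrite mulr_gt0// exprn_gt0.
have [_ [y yP <-] yq] := inf_adherent d0 (conj P0 lbP).
have t01 : 0 <= t <= 1 by rewrite ltW.
have [z zP] := potential_descent t01 respond yP.
have qz : q <= potential v z by apply: ge_inf => //; exists z.
have qy : q <= potential v y by apply: ge_inf => //; exists y.
rewrite -/N -/q in yq *.
move: (potential v y) (potential v z) qy qz yq => p p' qy qz yq zle.
have tq : t * q <= t * p by rewrite ler_wpM2l// ltW.
have e1 : t ^+ 2 * q + t ^+ 2 * N = t * q by rewrite -mulrDr expr2 -mulrA tN.
have tq0 : 0 < t * q by rewrite mulr_gt0.
lra.
Qed.

(** A potential below [e ^+ 2] bounds each single squared excess, hence each excess by [e];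
    averaging the rows with weights [x] keeps the bound. *)
Theorem approx_minimax v e : 0 < e -> B2 != finset.set0 ->
  (forall x, distr_on B1 x -> exists2 y, distr_on B2 y & payoff x y <= v) ->
  exists2 y, distr_on B2 y &
    forall x, distr_on B1 x -> payoff x y <= v + e.
Proof.
move=> e0 B20 respond.
have e20 : 0 < e ^+ 2 by rewrite exprn_gt0.
have [y yP ye] := potential_small e20 B20 respond; exists y => // x xP.
rewrite -[v + e]mulr1 -(sum_distr_on xP) mulr_sumr; apply: ler_sum => a aB.
have /andP[xa0 _] := distr_on_le1 a xP.
rewrite ler_wpM2r// -lerBlDl.
have le_ex : row_payoff y a - v <= excess v y a by rewrite le_max lexx orbT.
apply: (le_trans le_ex).
have ex0 : 0 <= excess v y a by rewrite le_max lexx.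
rewrite -ler_sqr ?nnegrE//; last exact: ltW.
apply: le_trans (ltW ye); rewrite /potential (bigD1 a)//= lerDl.
by apply: sumr_ge0 => b _; exact: sqr_ge0.
Qed.

End Minimax.

(** * One-step values *)

Section Pre.
Variables (R : realType) (G : game R).
Implicit Types (k l : state G -> R) (s : state G) (x y : move G -> R).

Lemma mixed_neq0 i s : mixed i s !=set0.
Proof. exact/distr_on_neq0/avail_neq0. Qed.

(** Presents the one-step game at [s] as a matrix game, to which the minimax theorem applies. *)
Lemma expect_payoff s x y k :
  expect s x y k =
  payoff (fun a b => \sum_u trans s a b u * k u) (avail P1 s) (avail P2 s) x y.
Proof.
rewrite /expect /payoff /row_payoff /mtrans.
under eq_bigr => u _ do rewrite mulr_suml.
rewrite exchange_big/=; apply: eq_bigr => a _; rewrite mulr_suml.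
under eq_bigr => u _ do rewrite mulr_suml.
rewrite exchange_big/=; apply: eq_bigr => b _; rewrite !mulr_suml.
by apply: eq_bigr => u _; ring.
Qed.

Lemma mtrans_ge0 s x y u : mixed P1 s x -> mixed P2 s y -> 0 <= mtrans s x y u.
Proof.
move=> xP yP; apply: sumr_ge0 => a _; apply: sumr_ge0 => b _.
have [/(_ u) tr0 _] := trans_distr s a b.
have /andP[x0 _] := distr_on_le1 a xP.
have /andP[y0 _] := distr_on_le1 b yP.
by rewrite !mulr_ge0.
Qed.

Lemma expect_cst s x y c : mixed P1 s x -> mixed P2 s y ->
  expect s x y (fun _ => c) = c.
Proof.
move=> xP yP; rewrite expect_payoff /payoff /row_payoff.
rewrite -[RHS]mulr1 -(sum_distr_on xP) mulr_sumr.
apply: eq_bigr => a _; congr (_ * _).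
rewrite -[RHS]mulr1 -(sum_distr_on yP) mulr_sumr.
apply: eq_bigr => b _; congr (_ * _).
by have [_ tr1] := trans_distr s a b; rewrite -mulr_suml tr1 mul1r.
Qed.

Lemma expectD s x y k l :
  expect s x y (fun u => k u + l u) = expect s x y k + expect s x y l.
Proof. by rewrite -big_split/=; apply: eq_bigr => u _; rewrite mulrDr. Qed.

Lemma expectN s x y k : expect s x y (fun u => - k u) = - expect s x y k.
Proof. by rewrite -sumrN; apply: eq_bigr => u _; rewrite mulrN. Qed.

Lemma expect_le s x y k l c : mixed P1 s x -> mixed P2 s y ->
  (forall u, k u <= l u + c) -> expect s x y k <= expect s x y l + c.
Proof.
move=> xP yP kl; rewrite -[X in _ <= _ + X](expect_cst c xP yP) -expectD.
by apply: ler_sum => u _; rewrite ler_wpM2l// mtrans_ge0.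
Qed.

Lemma expect_for_le i s x y k l c : mixed i s x -> mixed (opponent i) s y ->
  (forall u, k u <= l u + c) ->
  expect_for i s x y k <= expect_for i s x y l + c.
Proof. by case: i => /= xP yP; exact: expect_le. Qed.

Lemma expect_for01 i s x y k : mixed i s x -> mixed (opponent i) s y ->
  valuation k -> 0 <= expect_for i s x y k <= 1.
Proof.
suff aux x' y' : mixed P1 s x' -> mixed P2 s y' -> valuation k ->
    0 <= expect s x' y' k <= 1 by case: i => /= xP yP; exact: aux.
move=> xP yP k01; apply/andP; split.
  rewrite -[0 in X in X <= _](expect_cst 0 xP yP) -[leRHS]addr0.
  by apply: expect_le => // u; rewrite addr0; case/andP: (k01 u).
rewrite -[1](expect_cst 1 xP yP) -[leRHS]addr0.
by apply: expect_le => // u; rewrite addr0; case/andP: (k01 u).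
Qed.

Lemma inf_expect_ge i s x k c :
  (forall y, mixed (opponent i) s y -> c <= expect_for i s x y k) ->
  c <= inf [set expect_for i s x y k | y in mixed (opponent i) s].
Proof.
move=> cle; apply: lb_le_inf; last by move=> _ [y yP <-]; exact: cle.
by have [y yP] := mixed_neq0 (opponent i) s; exists (expect_for i s x y k), y.
Qed.

Lemma inf_expect_le i s x y k : valuation k ->
  mixed i s x -> mixed (opponent i) s y ->
  inf [set expect_for i s x y k | y in mixed (opponent i) s]
  <= expect_for i s x y k.
Proof.
move=> k01 xP yP; apply: ge_inf; last by exists y.
by exists 0 => _ [z zP <-]; case/andP: (expect_for01 xP zP k01).
Qed.

Lemma Pre_ge i s x k c : valuation k -> mixed i s x ->
  (forall y, mixed (opponent i) s y -> c <= expect_for i s x y k) ->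
  c <= Pre i k s.
Proof.
move=> k01 xP cle; apply: (le_trans (inf_expect_ge cle)).
apply: ub_le_sup; last by exists x.
exists 1 => _ [z zP <-].
have [y yP] := mixed_neq0 (opponent i) s.
apply: (le_trans (inf_expect_le k01 zP yP)).
by case/andP: (expect_for01 zP yP k01).
Qed.

(** Replaces optimal moves: the supremum is used through moves that guarantee a strictly smaller
    bound, without attainment. *)
Lemma lt_Pre i s k c : valuation k -> c < Pre i k s ->
  exists2 x, mixed i s x &
    forall y, mixed (opponent i) s y -> c < expect_for i s x y k.
Proof.
move=> k01 /sup_gt[].
  have [x xP] := mixed_neq0 i s.
  by exists (inf [set expect_for i s x y k | y in mixed (opponent i) s]), x.
move=> _ [x xP <-] cx; exists x => // y yP.
exact: lt_le_trans cx (inf_expect_le k01 xP yP).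
Qed.

Lemma Pre_lt i s x k c : valuation k -> Pre i k s < c -> mixed i s x ->
  exists2 y, mixed (opponent i) s y & expect_for i s x y k < c.
Proof.
move=> k01 kc xP; apply: contrapT => no_y.
suff : c <= Pre i k s by rewrite leNgt kc.
apply: (Pre_ge k01 xP) => y yP; rewrite leNgt; apply/negP => yc.
by apply: no_y; exists y.
Qed.

(** Monotonicity for [c = 0] and nonexpansiveness for [c > 0] in one: a move guaranteeing a bound
    for [k] guarantees that bound minus [c] for [l]. *)
Lemma Pre_le i k l c s : valuation k -> valuation l ->
  (forall u, k u <= l u + c) -> Pre i k s <= Pre i l s + c.
Proof.
move=> k01 l01 kl; rewrite leNgt; apply/negP => lt_lk.
have [h1 h2] := midf_lt lt_lk.
have [x xP xlt] := lt_Pre k01 h2.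
move: h1; rewrite -ltrBrDr ltNge => /negP; apply.
apply: (Pre_ge l01 xP) => y yP; rewrite lerBlDr.
exact: le_trans (ltW (xlt y yP)) (expect_for_le xP yP kl).
Qed.

Lemma Pre01 i k : valuation k -> valuation (Pre i k).
Proof.
move=> k01 s; have [x xP] := mixed_neq0 i s; apply/andP; split.
  apply: (Pre_ge k01 xP) => y yP.
  by case/andP: (expect_for01 xP yP k01).
rewrite leNgt; apply/negP => /(lt_Pre k01)[z zP zlt].
have [y yP] := mixed_neq0 (opponent i) s.
by move: (zlt y yP); rewrite ltNge; case/andP: (expect_for01 zP yP k01) => _ ->.
Qed.

Lemma valuationN k : valuation k -> valuation (fun u => 1 - k u).
Proof. by move=> k01 u; have /andP[? ?] := k01 u; apply/andP; split; lra. Qed.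

Lemma expect1B s x y k : mixed P1 s x -> mixed P2 s y ->
  expect s x y (fun u => 1 - k u) = 1 - expect s x y k.
Proof. by move=> xP yP; rewrite expectD expectN expect_cst. Qed.

Lemma Pre2_dual k s : valuation k ->
  Pre P2 k s = 1 - Pre P1 (fun u => 1 - k u) s.
Proof.
move=> k01; have nk01 := valuationN k01.
apply/eqP; rewrite eq_le; apply/andP; split; rewrite leNgt; apply/negP => lt12.
  (* Weak duality: near-optimal moves of the two players, played against each other, contradict one
     another at the midpoint [c]. *)
  have [h1 h2] := midf_lt lt12.
  set c := (X in X < Pre P2 k s) in h2.
  have [y yP cy] := lt_Pre k01 h2.
  have [|x xP cx] := @lt_Pre P1 s _ (1 - c) nk01; first by rewrite /c; lra.
  by move: (cx y yP) (cy x xP) => /=; rewrite expect1B//; lra.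
(* Here minimax is used: player 2 can answer each [x], hence has one [y] that is nearly as good
   against all [x]. *)
have [h1 h2] := midf_lt lt12.
set c := (X in Pre P2 k s < X) in h1 h2.
(* Half the gap, so that [c - e] still exceeds [Pre P2 k s]. *)
pose e := (c - Pre P2 k s) / 2.
have e0 : 0 < e by rewrite /e; lra.
have respond x : mixed P1 s x -> exists2 y, mixed P2 s y &
    payoff (fun a b => \sum_u trans s a b u * (1 - k u))
      (avail P1 s) (avail P2 s) x y <= 1 - c.
  move=> xP; have [|y yP yc] := @Pre_lt P1 s x _ (1 - c) nk01 _ xP.
    by rewrite /c; lra.
  by exists y => //; rewrite -expect_payoff ltW.
have [y yP yle] := approx_minimax e0 (avail_neq0 P2 s) respond.
have : c - e <= Pre P2 k s.
  apply: (Pre_ge k01 yP) => x xP /=.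
  by have := yle x xP; rewrite -expect_payoff expect1B//; lra.
by rewrite /e; lra.
Qed.

End Pre.

(** * Fixpoints and the semantics of formulas *)

Section KnasterTarski.
Variables (T : choiceType) (D : set T) (le : T -> T -> Prop).
Hypothesis le_refl : forall x, le x x.
Hypothesis le_trans : forall x y z, le x y -> le y z -> le x z.
Hypothesis le_anti : forall x y, le x y -> le y x -> x = y.

(** The join lies in [K] but is least among the upper bounds in [D]: joins in [K] are those of [D].
    The empty [A] asks for a member of [K] below all of [D]. *)
Definition lub_closed (K : set T) : Prop :=
  forall A, A `<=` K -> exists m, [/\ K m, forall x, A x -> le x m &
    forall y, D y -> (forall x, A x -> le x y) -> le m y].

Lemma least_fixpoint_eq (F : T -> T) (x0 m : T) :
  is_least_fixpoint D le F m -> least_fixpoint D le F x0 = m.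
Proof.
move=> mP; apply: xget_unique => // y [Dy Fy ymin].
by case: mP => Dm Fm mmin; apply: le_anti; [exact: ymin|exact: mmin].
Qed.

(** Knaster-Tarski, with an induction principle as last clause: a join-closed invariant [K] of [F]
    contains the least fixpoint. *)
Lemma least_fixpointP (F : T -> T) (x0 : T) : lub_closed D ->
  (forall x, D x -> D (F x)) ->
  (forall x y, D x -> D y -> le x y -> le (F x) (F y)) ->
  let m := least_fixpoint D le F x0 in
  [/\ D m, F m = m, forall y, D y -> le (F y) y -> le m y &
      forall K, K `<=` D -> lub_closed K -> (forall x, K x -> K (F x)) -> K m].
Proof.
move=> lubD DF Fmono.
(* Only joins are given, so the meet of the pre-fixpoints is formed as the join of their lower
   bounds. *)
pose L := [set x | D x /\ forall y, D y -> le (F y) y -> le x y].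
have [|m [Dm mub mlub]] := lubD L; first by move=> x [].
have m_pre y : D y -> le (F y) y -> le m y.
  by move=> Dy Fy; apply: mlub => // x [_]; exact.
have Fm_le : le (F m) m.
  apply: mub; split; first exact: DF.
  by move=> y Dy Fy; apply: (le_trans _ Fy); apply: Fmono => //; exact: m_pre.
have Fm : F m = m.
  apply: le_anti => //; apply: m_pre; first exact: DF.
  by apply: Fmono => //; exact: DF.
have ml : is_least_fixpoint D le F m.
  by split=> // y Dy Fy; apply: m_pre => //; rewrite Fy.
rewrite (least_fixpoint_eq _ ml); split=> // K KD lubK KF.
(* The join [n] of the part of [K] below [m] is a pre-fixpoint, since [F n] is again in that part;
   hence [m] is below [n]. *)
have [|n [Kn nub nlub]] := lubK [set x | K x /\ le x m]; first by move=> x [].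
have nm : le n m by apply: nlub => // x [].
suff mn : le m n by rewrite (le_anti mn nm).
apply: m_pre; first exact: KD.
apply: nub; split; first exact: KF.
by rewrite -Fm; apply: Fmono => //; exact: KD.
Qed.

End KnasterTarski.

(** * Complete lattices of valuations *)

Section Valuations.
Variables (R : realType) (G : game R).
Implicit Types (f g k : state G -> R) (d : state G -> state G -> R).

Lemma val_le_refl f : val_le f f. Proof. by []. Qed.

Lemma val_le_trans f g k : val_le f g -> val_le g k -> val_le f k.
Proof. by move=> fg gk u; exact: le_trans (fg u) (gk u). Qed.

Lemma val_le_anti f g : val_le f g -> val_le g f -> f = g.
Proof.
by move=> fg gf; apply/funext => u; apply/eqP; rewrite eq_le fg gf.
Qed.

Lemma lub_closed_C d : (forall u v, 0 <= d u v) ->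
  lub_closed (@valuation R G) (@val_le R G) (C d).
Proof.
move=> d0 A AC.
(* Adding 0 makes the join of the empty family the least valuation and changes no other join, as
   valuations are non-negative. *)
pose E u := 0 |` [set f u | f in A].
have E0 u : E u !=set0 by exists 0; left.
have E1 u : ubound (E u) 1.
  by move=> _ [->//|[f /AC[f01 _] <-]]; case/andP: (f01 u).
have Esup u x : E u x -> x <= sup (E u).
  by move=> Ex; apply: ub_le_sup => //; exists 1.
exists (fun u => sup (E u)); split.
- split=> [u|u v].
    by rewrite Esup; [apply: ge_sup|left].
  rewrite lerBlDr; apply: ge_sup => // _ [->|[f fA <-]].
    by rewrite addr_ge0// Esup//; left.
  have [_ /(_ u v)] := AC f fA; rewrite lerBlDr => /le_trans; apply.
  by rewrite lerD2l Esup//; right; exists f.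
- by move=> f fA u; apply: Esup; right; exists f.
- move=> g g01 gub u; apply: ge_sup => // _ [->|[f fA <-]].
    by case/andP: (g01 u).
  exact: gub.
Qed.

Lemma C1B d k : C d k -> C (converse d) (fun u => 1 - k u).
Proof.
move=> [k01 kd]; split; first exact: valuationN.
by move=> u v; have := kd v u; rewrite /converse; lra.
Qed.

(** The order-reversing map [k] to [1 - k] carries [C d] into [C (converse d)], which turns meets
    into joins. *)
Lemma glb_closed_C d : (forall u v, 0 <= d u v) ->
  lub_closed (@valuation R G) (fun f g => @val_le R G g f) (C d).
Proof.
move=> d0 A AC.
have [||m [mC mub mlub]] := @lub_closed_C (converse d) _
    [set (fun u => 1 - f u) | f in A].
- by move=> u v; exact: d0.
- by move=> _ [f /AC fC <-]; exact: C1B.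
exists (fun u => 1 - m u); split.
- exact: C1B.
- move=> f fA u; have := mub (fun u => 1 - f u) (ex_intro2 _ _ f fA erefl) u.
  by rewrite /=; lra.
- move=> g /valuationN g01 glb u.
  suff /(_ u) : val_le m (fun u => 1 - g u) by lra.
  by apply: mlub => // _ [f fA <-] v; have := glb f fA v; lra.
Qed.

(** Makes the completeness of all valuations an instance of that of [C d]. *)
Lemma C_valuation : C (fun _ _ => 1) = @valuation R G.
Proof.
apply/seteqP; split=> [k []//|k k01]; split=> // u v.
by have /andP[? ?] := k01 u; have /andP[? ?] := k01 v; lra.
Qed.

Lemma lub_closed_valuation :
  lub_closed (@valuation R G) (@val_le R G) (@valuation R G).
Proof. by rewrite -{2}C_valuation; exact: lub_closed_C. Qed.

Lemma glb_closed_valuation :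
  lub_closed (@valuation R G) (fun f g => @val_le R G g f) (@valuation R G).
Proof. by rewrite -{2}C_valuation; exact: glb_closed_C. Qed.

End Valuations.

(** * Monotonicity and fixpoint semantics of formulas *)

Section Semantics.
Variables (R : realType) (G : game R).
Implicit Types (phi p : formula G) (xi : env G).

Lemma update_all (K : set (state G -> R)) xi Z f :
  (forall Y, K (xi Y)) -> K f -> forall Y, K (update xi Z f Y).
Proof. by move=> Kxi Kf Y; rewrite /update; case: ifP. Qed.

Lemma sem_valuation phi xi : well_formed phi ->
  (forall Z, valuation (xi Z)) -> valuation (sem phi xi).
Proof.
(* The default value 0 is a valuation too, so this holds before any fixpoint is known to exist. *)
have fix0 le F :
    valuation (@least_fixpoint (state G -> R) (@valuation R G) le F (fun=> 0)).
  rewrite /least_fixpoint; case: xgetP => [y _ []//|_ s].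
  by rewrite lexx ler01.
elim: phi xi => //=.
- by move=> c xi c01 _ s.
- by move=> v xi _ _ s; exact: obs01.
- by move=> p IH xi wp xi01; apply: valuationN; exact: IH.
- move=> p IHp q IHq xi /andP[wp wq] xi01 s.
  by rewrite /Num.max; case: ifP => _; [exact: IHq|exact: IHp].
- move=> p IHp q IHq xi /andP[wp wq] xi01 s.
  by rewrite /Num.min; case: ifP => _; [exact: IHp|exact: IHq].
- move=> p _ c xi _ _ s.
  by rewrite le_min ge_min le_max ler01 !lexx ?orbT.
- move=> p _ c xi _ _ s.
  by rewrite le_max ge_max ge_min ler01 !lexx ?orbT.
- by move=> i p IH xi wp xi01; apply: Pre01; exact: IH.
Qed.

(** The two parities impose opposite inequalities, so a negation just exchanges [xi] and [xi'] in
    the induction. *)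
Definition sem_monotone p : Prop := forall xi xi',
  (forall Z, valuation (xi Z)) -> (forall Z, valuation (xi' Z)) ->
  (forall Z, occurs Z false p -> val_le (xi Z) (xi' Z)) ->
  (forall Z, occurs Z true p -> val_le (xi' Z) (xi Z)) ->
  val_le (sem p xi) (sem p xi').

Lemma sem_update_mono p Z xi f g : sem_monotone p -> ~~ occurs Z true p ->
  (forall Y, valuation (xi Y)) -> valuation f -> valuation g ->
  val_le f g -> val_le (sem p (update xi Z f)) (sem p (update xi Z g)).
Proof.
move=> pmono noZ xi01 f01 g01 fg; apply: pmono; try exact: update_all.
- by move=> Y _; rewrite /update; case: ifP => // _ u.
- move=> Y; rewrite /update; case: eqP => [->|_ _ u//].
  by rewrite (negbTE noZ).
Qed.

(** Monotonicity of the body is a hypothesis because its proof by induction on formulas uses this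
    lemma. The last clause is fixpoint induction inside [C d]. *)
Lemma sem_FMuP p Z xi : sem_monotone p -> well_formed (FMu Z p) ->
  (forall Y, valuation (xi Y)) ->
  let F f := sem p (update xi Z f) in let m := sem (FMu Z p) xi in
  [/\ F m = m, forall f, valuation f -> val_le (F f) f -> val_le m f &
      forall d, (forall u v, 0 <= d u v) ->
        (forall f, C d f -> C d (F f)) -> C d m].
Proof.
move=> pmono /andP[wp noZ] xi01 F m.
have [||m01 Fm mpre mK] := least_fixpointP (@val_le_refl R G)
  (@val_le_trans R G) (@val_le_anti R G) (F := F) (fun=> 0)
  (@lub_closed_valuation R G).
- by move=> f f01; apply: sem_valuation => //; exact: update_all.
- by move=> f g f01 g01; exact: sem_update_mono.
split=> // d d0 Fd; apply: mK => //; last exact: lub_closed_C.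
by move=> f [].
Qed.

Lemma sem_FNuP p Z xi : sem_monotone p -> well_formed (FNu Z p) ->
  (forall Y, valuation (xi Y)) ->
  let F f := sem p (update xi Z f) in let m := sem (FNu Z p) xi in
  [/\ F m = m, forall f, valuation f -> val_le f (F f) -> val_le f m &
      forall d, (forall u v, 0 <= d u v) ->
        (forall f, C d f -> C d (F f)) -> C d m].
Proof.
move=> pmono /andP[wp noZ] xi01 F m.
have [||||m01 Fm mpre mK] := @least_fixpointP _ (@valuation R G)
  (fun f g => @val_le R G g f) (@val_le_refl R G) _ _ F (fun=> 0)
  (@glb_closed_valuation R G).
- by move=> f g h fg gh; exact: val_le_trans gh fg.
- by move=> f g fg gf; exact: val_le_anti gf fg.
- by move=> f f01; apply: sem_valuation => //; exact: update_all.
- by move=> f g f01 g01 gf; exact: sem_update_mono.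
split=> // d d0 Fd; apply: mK => //; last exact: glb_closed_C.
by move=> f [].
Qed.

Lemma sem_mono phi : well_formed phi -> sem_monotone phi.
Proof.
elim: phi => //=.
- by move=> c _ xi xi' _ _ _ _ s.
- by move=> v _ xi xi' _ _ _ _ s.
- by move=> Z _ xi xi' _ _ pos _; apply: pos; rewrite /= eqxx.
- move=> p IH wp xi xi' xi01 xi01' pos neg s /=.
  by have := IH wp xi' xi xi01' xi01 neg pos s; lra.
- move=> p IHp q IHq /andP[wp wq] xi xi' xi01 xi01' /= pos neg s.
  have pxi : val_le (sem p xi) (sem p xi').
    by apply: IHp => // Z oZ; [apply: pos|apply: neg]; rewrite oZ.
  have qxi : val_le (sem q xi) (sem q xi').
    by apply: IHq => // Z oZ; [apply: pos|apply: neg]; rewrite oZ orbT.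
  by rewrite /= ge_max !le_max pxi qxi orbT.
- move=> p IHp q IHq /andP[wp wq] xi xi' xi01 xi01' /= pos neg s.
  have pxi : val_le (sem p xi) (sem p xi').
    by apply: IHp => // Z oZ; [apply: pos|apply: neg]; rewrite oZ.
  have qxi : val_le (sem q xi) (sem q xi').
    by apply: IHq => // Z oZ; [apply: pos|apply: neg]; rewrite oZ orbT.
  by rewrite /= le_min !ge_min pxi qxi orbT.
- move=> p IH c /andP[wp _] xi xi' xi01 xi01' pos neg s /=.
  have := IH wp xi xi' xi01 xi01' pos neg s => h.
  by rewrite le_min !ge_min !ge_max !le_max ?lexx lerD2r h ?orbT ?ler01.
- move=> p IH c /andP[wp _] xi xi' xi01 xi01' pos neg s /=.
  have := IH wp xi xi' xi01 xi01' pos neg s => h.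
  by rewrite ge_max !le_max !le_min !ge_min ?lexx lerD2r h ?orbT ?ler01.
- move=> i p IH wp xi xi' xi01 xi01' pos neg s /=.
  rewrite -[leRHS]addr0; apply: Pre_le; try exact: sem_valuation.
  by move=> u; rewrite addr0; exact: IH.
- move=> Z p IH wf xi xi' xi01 xi01' pos neg.
  have /andP[wp _] := wf; have pmono := IH wp.
  have [_ mpre _] := sem_FMuP pmono wf xi01.
  have [Fm' _ _] := sem_FMuP pmono wf xi01'.
  have m01' : valuation (sem (FMu Z p) xi') by exact: sem_valuation.
  (* The fixpoint under [xi'] is a pre-fixpoint of the body under [xi], so it lies above the least
     one. *)
  apply: mpre => //; rewrite -[X in val_le _ X]Fm'.
  apply: pmono; try exact: update_all.
  + move=> Y oY; rewrite /update; case: eqVneq => [_ u //|YZ].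
    by apply: pos; rewrite /= eq_sym YZ.
  + move=> Y oY; rewrite /update; case: eqVneq => [_ u //|YZ].
    by apply: neg; rewrite /= eq_sym YZ.
- move=> Z p IH wf xi xi' xi01 xi01' pos neg.
  have /andP[wp _] := wf; have pmono := IH wp.
  have [Fm _ _] := sem_FNuP pmono wf xi01.
  have [_ mpre' _] := sem_FNuP pmono wf xi01'.
  have m01 : valuation (sem (FNu Z p) xi) by exact: sem_valuation.
  apply: mpre' => //; rewrite -[X in val_le X _]Fm.
  apply: pmono; try exact: update_all.
  + move=> Y oY; rewrite /update; case: eqVneq => [_ u //|YZ].
    by apply: pos; rewrite /= eq_sym YZ.
  + move=> Y oY; rewrite /update; case: eqVneq => [_ u //|YZ].
    by apply: neg; rewrite /= eq_sym YZ.
Qed.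

End Semantics.

(** * Formulas are Lipschitz for every pre-fixpoint *)

Section Soundness.
Variables (R : realType) (G : game R).
Implicit Types (k : state G -> R) (d e : state G -> state G -> R).
Implicit Types (s t u v : state G) (phi : formula G) (xi : env G).

Lemma C_cst d c : (forall u v, 0 <= d u v) -> 0 <= c <= 1 -> C d (fun=> c).
Proof. by move=> d0 c01; split=> // u v; rewrite subrr. Qed.

Lemma obs_dist_ge0 s t : 0 <= obs_dist s t.
Proof. exact: bigmax_ge_id. Qed.

Lemma has_ubound_Pre i d s t :
  has_ubound [set Pre i k s - Pre i k t | k in C d].
Proof.
exists 1 => _ [k [k01 _] <-].
have /andP[? ?] := Pre01 i k01 s; have /andP[? ?] := Pre01 i k01 t; lra.
Qed.

Lemma obs_dist_le_Hsim i d s t : obs_dist s t <= Hsim i d s t.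
Proof. by rewrite /Hsim le_max lexx. Qed.

Lemma Hsim_ge0 i d s t : 0 <= Hsim i d s t.
Proof. exact: le_trans (obs_dist_ge0 s t) (obs_dist_le_Hsim i d s t). Qed.

Lemma Pre_le_Hsim i d k s t : C d k -> Pre i k s - Pre i k t <= Hsim i d s t.
Proof.
move=> kC; rewrite /Hsim le_max; apply/orP; right.
by apply: ub_le_sup; [exact: has_ubound_Pre|exists k].
Qed.

Lemma Hsim_le i d s t c : (forall u v, 0 <= d u v) -> obs_dist s t <= c ->
  (forall k, C d k -> Pre i k s - Pre i k t <= c) -> Hsim i d s t <= c.
Proof.
move=> d0 oc kc; rewrite /Hsim ge_max oc/=.
apply: ge_sup; last by move=> _ [k kC <-]; exact: kc.
exists (Pre i (fun=> 0) s - Pre i (fun=> 0) t), (fun=> 0) => //.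
by apply: C_cst => //; rewrite lexx ler01.
Qed.

Lemma Hsim_mono i d e : (forall u v, 0 <= d u v) -> metric_le d e ->
  metric_le (Hsim i d) (Hsim i e).
Proof.
move=> d0 de s t; apply: Hsim_le => //; first exact: obs_dist_le_Hsim.
move=> k [k01 kd]; apply: Pre_le_Hsim; split=> // u v.
exact: le_trans (kd u v) (de u v).
Qed.

Lemma clamp_lipschitz (a b c : R) : 0 <= c -> a - b <= c ->
  Num.min 1 (Num.max 0 a) - Num.min 1 (Num.max 0 b) <= c.
Proof.
move=> c0 abc; case: (leP 0 a) => ?; case: (leP 0 b) => ?;
  by case: (leP 1 a) => ?; case: (leP 1 b) => ?;
     case: (leP (1 : R) 0) => ?; lra.
Qed.

(** Reconciles the truncation orders of [FMinus] and [FPlus]. *)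
Lemma clampC (a : R) :
  Num.max 0 (Num.min 1 a) = Num.min 1 (Num.max 0 a).
Proof. by rewrite max_minr (max_r ler01). Qed.

(** Environments range over [C d] so that the induction reaches the open bodies of fixpoints.
    Symmetry of [d] serves general negation and, by duality, [pre_2]. *)
Lemma sem_C d phi xi : (forall u v, 0 <= d u v) -> metric_le (Hsim P1 d) d ->
  well_formed phi -> positive1 phi \/ (forall u v, d u v = d v u) ->
  (forall Z, C d (xi Z)) -> C d (sem phi xi).
Proof.
move=> d0 Hd.
have C1 k : C d k -> C d (Pre P1 k).
  move=> kC; have [k01 _] := kC; split=> [|u v]; first exact: Pre01.
  exact: le_trans (Pre_le_Hsim P1 u v kC) (Hd u v).
have obsd o s t : `|obs o s - obs o t| <= d s t.
  apply: le_trans (Hd s t); apply: le_trans (obs_dist_le_Hsim _ _ _ _).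
  exact: le_bigmax.
have CN k : (forall u v, d u v = d v u) -> C d k -> C d (fun u => 1 - k u).
  move=> dsym kC; have := C1B kC; congr (C _ _).
  by apply/funext => u; apply/funext => v; exact: dsym.
have C2 k : (forall u v, d u v = d v u) -> C d k -> C d (Pre P2 k).
  move=> dsym kC; have [k01 _] := kC.
  have -> : Pre P2 k = (fun u => 1 - Pre P1 (fun u => 1 - k u) u).
    by apply/funext => u; exact: Pre2_dual.
  by apply: (CN) => //; apply: C1; exact: CN.
have xi01 xi' : (forall Z, C d (xi' Z)) -> forall Z, valuation (xi' Z).
  by move=> Cxi Z; have [] := Cxi Z.
elim: phi xi => //=.
- by move=> c xi c01 _ _; exact: C_cst.
- move=> v xi _ _ _; split=> [s|s t]; first exact: obs01.
  exact: le_trans (ler_norm _) (obsd v s t).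
- move=> p IH xi wp [|dsym Cxi]; last first.
    by apply: CN => //; apply: IH => //; right.
  (* In a positive formula only an observation is negated, and [obsd] bounds its differences in both
     directions. *)
  case: p wp {IH} => //= v _ _ _; split; first exact/valuationN/obs01.
  by move=> s t; have := obsd v s t; rewrite ler_norml => /andP[]; lra.
- move=> p IHp q IHq xi /andP[wp wq] pos Cxi.
  have [p01 pd] : C d (sem p xi).
    by apply: IHp => //; case: pos => [/andP[]|]; auto.
  have [q01 qd] : C d (sem q xi).
    by apply: IHq => //; case: pos => [/andP[]|]; auto.
  split=> [s|s t]; first by rewrite /Num.max; case: ifP.
  have := pd s t; have := qd s t.
  by case: (leP (sem p xi s)) => ?; case: (leP (sem p xi t)) => ?; lra.
- move=> p IHp q IHq xi /andP[wp wq] pos Cxi.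
  have [p01 pd] : C d (sem p xi).
    by apply: IHp => //; case: pos => [/andP[]|]; auto.
  have [q01 qd] : C d (sem q xi).
    by apply: IHq => //; case: pos => [/andP[]|]; auto.
  split=> [s|s t]; first by rewrite /Num.min; case: ifP.
  have := pd s t; have := qd s t.
  by case: (leP (sem p xi s)) => ?; case: (leP (sem p xi t)) => ?; lra.
- move=> p IH c xi /andP[wp c01] pos Cxi; have [p01 pd] := IH xi wp pos Cxi.
  split=> [|s t]; last by apply: clamp_lipschitz => //; have := pd s t; lra.
  by apply: (@sem_valuation _ _ (FPlus p c)) => //=; [rewrite wp|exact: xi01].
- move=> p IH c xi /andP[wp c01] pos Cxi; have [p01 pd] := IH xi wp pos Cxi.
  split=> [|s t].
    by apply: (@sem_valuation _ _ (FMinus p c)) => //=;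
      [rewrite wp|exact: xi01].
  by rewrite !clampC; apply: clamp_lipschitz => //; have := pd s t; lra.
- move=> [] p IH xi wp pos Cxi; first by apply: C1; exact: IH.
  by case: pos => // dsym; apply: C2 => //; apply: IH => //; right.
- move=> Z p IH xi wf pos Cxi; have /andP[wp _] := wf.
  have [_ _ Cm] := sem_FMuP (sem_mono wp) wf (xi01 _ Cxi).
  by apply: Cm => // f fC; apply: IH => //; exact: update_all.
- move=> Z p IH xi wf pos Cxi; have /andP[wp _] := wf.
  have [_ _ Cm] := sem_FNuP (sem_mono wp) wf (xi01 _ Cxi).
  by apply: Cm => // f fC; apply: IH => //; exact: update_all.
Qed.

Lemma den_valuation phi : qmu phi -> valuation (den phi).
Proof.
by move=> [wf _]; apply: sem_valuation => // Z s; rewrite lexx ler01.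
Qed.

Lemma den_le_metric d phi s t : (forall u v, 0 <= d u v) ->
  metric_le (Hsim P1 d) d -> qmu phi ->
  positive1 phi \/ (forall u v, d u v = d v u) ->
  den phi s - den phi t <= d s t.
Proof.
move=> d0 Hd [wf _] pos.
have [//|_] := @sem_C d phi (fun _ _ => 0) d0 Hd wf pos; last exact.
by move=> Z; apply: C_cst => //; rewrite lexx ler01.
Qed.

End Soundness.

(** * The logical distance is a pre-fixpoint *)

Section LogicalDistance.
Variables (R : realType) (G : game R).
Implicit Types (k : state G -> R) (d : state G -> state G -> R).
Implicit Types (s t u v : state G) (phi : formula G) (Phi : set (formula G)).

Definition logical_dist Phi s t : R :=
  sup [set den phi s - den phi t | phi in Phi].

(** What the approximation argument asks of a logic, so that one proof covers [qmu] and [qmu1_pos].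
    Negated observations match the absolute value in [obs_dist]. *)
Record pre_lattice Phi : Prop := PreLattice {
  pl_qmu : Phi `<=` @qmu R G;
  pl_cst : forall c, 0 <= c <= 1 -> Phi (FConst G c);
  pl_obs : forall o, Phi (FObs o) /\ Phi (FNeg (FObs o));
  pl_or : forall p q, Phi p -> Phi q -> Phi (FOr p q);
  pl_and : forall p q, Phi p -> Phi q -> Phi (FAnd p q);
  pl_plus : forall p c, Phi p -> 0 <= c <= 1 -> Phi (FPlus p c);
  pl_minus : forall p c, Phi p -> 0 <= c <= 1 -> Phi (FMinus p c);
  pl_pre : forall p, Phi p -> Phi (FPre P1 p)
}.

Lemma pre_lattice_qmu : pre_lattice (@qmu R G).
Proof.
split=> //.
- by move=> p q [wp cp] [wq cq]; split; rewrite /= ?wp//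
     /Defs.closed/= cat_nilp; apply/andP.
- by move=> p q [wp cp] [wq cq]; split; rewrite /= ?wp//
     /Defs.closed/= cat_nilp; apply/andP.
- by move=> p c [wp cp] c01; split; rewrite //= wp.
- by move=> p c [wp cp] c01; split; rewrite //= wp.
Qed.

Lemma pre_lattice_qmu1_pos : pre_lattice (@qmu1_pos R G).
Proof.
have [_ Hc Ho Hor Hand Hp Hm Hpre] := pre_lattice_qmu.
split.
- by move=> p [].
- by move=> c c01; split=> //; exact: Hc.
- by move=> o; have [] := Ho o; split.
- by move=> p q [qp pp] [qq pq]; split; [exact: Hor|rewrite /= pp].
- by move=> p q [qp pp] [qq pq]; split; [exact: Hand|rewrite /= pp].
- by move=> p c [qp pp] c01; split; [exact: Hp|].
- by move=> p c [qp pp] c01; split; [exact: Hm|].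
- by move=> p [qp pp]; split; [exact: Hpre|].
Qed.

Section PreLatticeTheory.
Variable Phi : set (formula G).
Hypothesis PhiP : pre_lattice Phi.

Lemma den_diff_le1 phi s t : Phi phi -> den phi s - den phi t <= 1.
Proof.
move=> /(pl_qmu PhiP)/den_valuation v01.
by have /andP[? ?] := v01 s; have /andP[? ?] := v01 t; lra.
Qed.

Lemma has_sup_logical_dist s t :
  has_sup [set den phi s - den phi t | phi in Phi].
Proof.
split; last by exists 1 => _ [phi phiP <-]; exact: den_diff_le1.
exists (den (FConst G 0) s - den (FConst G 0) t), (FConst G 0) => //.
by apply: (pl_cst PhiP); rewrite lexx ler01.
Qed.

Lemma logical_dist_ge phi s t : Phi phi ->
  den phi s - den phi t <= logical_dist Phi s t.
Proof.
move=> phiP; apply: ub_le_sup; last by exists phi.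
by have [] := has_sup_logical_dist s t.
Qed.

Lemma logical_dist_le s t c :
  (forall phi, Phi phi -> den phi s - den phi t <= c) ->
  logical_dist Phi s t <= c.
Proof.
move=> le_c; apply: ge_sup; last by move=> _ [phi /le_c + <-].
by have [] := has_sup_logical_dist s t.
Qed.

Lemma logical_dist_ge0 s t : 0 <= logical_dist Phi s t.
Proof.
have c01 : 0 <= (0 : R) <= 1 by rewrite lexx ler01.
by have := logical_dist_ge s t (pl_cst PhiP c01); rewrite subrr.
Qed.

Lemma logical_dist_metric : directed_metric (logical_dist Phi).
Proof.
split=> [s t|s|s t u]; first exact: logical_dist_ge0.
- apply/eqP; rewrite eq_le logical_dist_ge0 andbT.
  by apply: logical_dist_le => phi _; rewrite subrr.
- apply: logical_dist_le => phi phiP.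
  by have := logical_dist_ge s t phiP; have := logical_dist_ge t u phiP; lra.
Qed.

(* Shift a formula that nearly separates u from v so that it agrees with k at
   u; truncation at 0 and 1 does no harm since k takes values in [0, 1]. *)
Lemma approx_pair k e u v : C (logical_dist Phi) k -> 0 < e ->
  exists2 phi, Phi phi & k u <= den phi u /\ den phi v <= k v + e.
Proof.
move=> [k01 kd] e0.
have [_ [phi phiP <-] lt_phi] := sup_adherent e0 (has_sup_logical_dist u v).
have := kd u v; rewrite /logical_dist => kuv.
have v01 := den_valuation (pl_qmu PhiP phiP).
have /andP[ku0 ku1] := k01 u; have /andP[kv0 kv1] := k01 v.
have /andP[pu0 pu1] := v01 u; have /andP[pv0 pv1] := v01 v.
have [le_ku|lt_ku] := leP (k u) (den phi u).
- exists (FMinus phi (den phi u - k u)).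
    by apply: (pl_minus PhiP) => //; apply/andP; split; lra.
  rewrite /den/= -/(den phi) le_max le_min ge_max ge_min; split.
    by apply/orP; right; apply/andP; split; lra.
  by apply/andP; split; [lra|apply/orP; right; lra].
- exists (FPlus phi (k u - den phi u)).
    by apply: (pl_plus PhiP) => //; apply/andP; split; lra.
  rewrite /den/= -/(den phi) le_min le_max ge_min ge_max; split.
    by apply/andP; split; [lra|apply/orP; right; lra].
  by apply/orP; right; apply/andP; split; lra.
Qed.

(** The conjunction over all [v] of the formulas for the pairs [u], [v]: each is at least [k u] at
    [u], and one is small at each [v]. The empty conjunction is the constant 1. *)
Lemma approx_below k e u : C (logical_dist Phi) k -> 0 < e ->
  exists2 phi, Phi phi & k u <= den phi u /\ forall v, den phi v <= k v + e.
Proof.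
move=> kC e0; have [k01 _] := kC.
suff [phi phiP [ku kv]] : exists2 phi, Phi phi & k u <= den phi u /\
    forall v, v \in enum (state G) -> den phi v <= k v + e.
  by exists phi => //; split=> // v; apply: kv; rewrite mem_enum.
elim: (enum _) => [|w r [phi phiP [ku kv]]].
  exists (FConst G 1); first by apply: (pl_cst PhiP); rewrite lexx ler01.
  by split=> //; case/andP: (k01 u).
have [psi psiP [psiu psiw]] := approx_pair u w kC e0.
exists (FAnd psi phi); first exact: (pl_and PhiP).
rewrite /den/= -/(den phi) -/(den psi); split; first by rewrite le_min psiu.
move=> v; rewrite inE ge_min => /predU1P[->|/kv ->]; last by rewrite orbT.
by rewrite psiw.
Qed.

(** The disjunction over all [u] of the formulas from [approx_below], starting from the constant
    0. *)
Lemma approx_valuation k e : C (logical_dist Phi) k -> 0 < e ->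
  exists2 phi, Phi phi & forall v, k v <= den phi v <= k v + e.
Proof.
move=> kC e0; have [k01 _] := kC.
suff [phi phiP [ku kv]] : exists2 phi, Phi phi &
    (forall u, u \in enum (state G) -> k u <= den phi u) /\
    forall v, den phi v <= k v + e.
  by exists phi => // v; rewrite ku ?kv// mem_enum.
elim: (enum _) => [|w r [phi phiP [ku kv]]].
  exists (FConst G 0); first by apply: (pl_cst PhiP); rewrite lexx ler01.
  by split=> // v; case/andP: (k01 v) => ? _; rewrite addr_ge0// ltW.
have [psi psiP [psiw psiv]] := approx_below w kC e0.
exists (FOr psi phi); first exact: (pl_or PhiP).
rewrite /den/= -/(den phi) -/(den psi); split; last first.
  by move=> v; rewrite ge_max psiv kv.
move=> v; rewrite inE le_max => /predU1P[->|/ku ->]; last by rewrite orbT.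
by rewrite psiw.
Qed.

Lemma Hsim_logical_dist_le :
  metric_le (Hsim P1 (logical_dist Phi)) (logical_dist Phi).
Proof.
move=> s t; apply: Hsim_le; first exact: logical_dist_ge0.
  apply: bigmax_le => [|o _]; first exact: logical_dist_ge0.
  (* The observation and its negation give the two signs of the absolute value. *)
  have [oP noP] := pl_obs PhiP o.
  have := logical_dist_ge s t oP; have := logical_dist_ge s t noP.
  by rewrite /den/= ler_norml => ? ?; apply/andP; split; lra.
move=> k kC; apply/ler_addgt0Pr => e e0.
(* As [phi] lies between [k] and [k + e], replacing [k] by it costs nothing at [s] and at most [e]
   at [t]; the remaining difference is that of [FPre P1 phi]. *)
have [phi phiP phik] := approx_valuation kC e0; have [k01 _] := kC.
have v01 := den_valuation (pl_qmu PhiP phiP).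
have h1 : Pre P1 k s <= Pre P1 (den phi) s + 0.
  by apply: Pre_le => // u; rewrite addr0; case/andP: (phik u).
have h2 : Pre P1 (den phi) t <= Pre P1 k t + e.
  by apply: Pre_le => // u; case/andP: (phik u).
have := logical_dist_ge s t (pl_pre PhiP phiP).
by rewrite /den/= -/(den phi); lra.
Qed.

End PreLatticeTheory.

(** * Identification of the metrics with the logical distances *)

Lemma metric_le_anti (d e : state G -> state G -> R) :
  metric_le d e -> metric_le e d -> d = e.
Proof.
move=> de ed; apply/funext => s; apply/funext => t.
by apply/eqP; rewrite eq_le de ed.
Qed.

Lemma sim_metric_logical : sim_metric P1 = logical_dist (@qmu1_pos R G).
Proof.
have PhiP := pre_lattice_qmu1_pos.
have sound d : (forall u v, 0 <= d u v) -> metric_le (Hsim P1 d) d ->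
    metric_le (logical_dist (@qmu1_pos R G)) d.
  move=> d0 Hd s t; apply: (logical_dist_le PhiP) => phi [qphi pos].
  by apply: den_le_metric => //; left.
have L0 := logical_dist_ge0 PhiP; have HL := Hsim_logical_dist_le PhiP.
apply: (least_fixpoint_eq metric_le_anti); split.
- exact: logical_dist_metric.
(* Applying the monotone [Hsim P1] to [HL] shows that [Hsim P1] of the logical distance is a
   pre-fixpoint, hence above the logical distance. *)
- apply: metric_le_anti => //; apply: sound; first exact: Hsim_ge0.
  by apply: Hsim_mono => //; exact: Hsim_ge0.
- by move=> d [d0 _ _] Hd; apply: sound => //; rewrite Hd.
Qed.

Lemma logical_dist_qmu_sym s t :
  logical_dist (@qmu R G) s t = logical_dist (@qmu R G) t s.
Proof.
have PhiP := pre_lattice_qmu.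
suff le_sym u v : logical_dist (@qmu R G) u v <= logical_dist (@qmu R G) v u.
  by apply/eqP; rewrite eq_le !le_sym.
apply: (logical_dist_le PhiP) => phi phiP.
have nP : qmu (FNeg phi) by [].
by have := logical_dist_ge PhiP v u nP; rewrite /den/= -/(den phi); lra.
Qed.

(** Values of [Hbisim] are symmetric and dominate [Hsim], so each of its fixpoints is a symmetric
    pre-fixpoint of [Hsim], as soundness of the full logic demands. *)
Lemma bisim_metric_logical : @game_bisim_metric R G = logical_dist (@qmu R G).
Proof.
have PhiP := pre_lattice_qmu.
have sound d : (forall u v, 0 <= d u v) -> (forall u v, d u v = d v u) ->
    metric_le (Hsim P1 d) d -> metric_le (logical_dist (@qmu R G)) d.
  move=> d0 dsym Hd s t; apply: (logical_dist_le PhiP) => phi qphi.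
  by apply: den_le_metric => //; right.
have L0 := logical_dist_ge0 PhiP; have HL := Hsim_logical_dist_le PhiP.
have Hbi_sym d u v : Hbisim P1 d u v = Hbisim P1 d v u.
  by rewrite /Hbisim /metric_max maxC.
have sim_le_bi d : metric_le (Hsim P1 d) (Hbisim P1 d).
  by move=> u v; rewrite /Hbisim /metric_max le_max lexx.
have Hbi0 d u v : 0 <= Hbisim P1 d u v.
  exact: le_trans (Hsim_ge0 P1 d u v) (sim_le_bi d u v).
have HbL : metric_le (Hbisim P1 (logical_dist (@qmu R G)))
    (logical_dist (@qmu R G)).
  move=> u v; rewrite /Hbisim /metric_max ge_max HL/=.
  by rewrite /converse logical_dist_qmu_sym; exact: HL.
apply: (least_fixpoint_eq metric_le_anti); split.
- exact: logical_dist_metric.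
- apply: metric_le_anti => //; apply: sound => //.
  (* By [HbL] and monotonicity, [Hsim] at the [Hbisim] image of the logical distance is at most
     [Hsim] at the logical distance, which that image dominates. *)
  move=> u v; apply: le_trans (sim_le_bi _ u v).
  exact: (Hsim_mono P1 (Hbi0 _) HbL).
- move=> d [d0 _ _] Hd; apply: sound => //; last first.
    by rewrite -[X in metric_le _ X]Hd.
  by move=> u v; rewrite -Hd.
Qed.

(** The logical distance of the full logic is symmetric, so it bounds the differences of either
    sign. *)
Lemma sup_norm_logical_dist s t :
  sup [set `|den phi s - den phi t| | phi in @qmu R G]
  = logical_dist (@qmu R G) s t.
Proof.
have PhiP := pre_lattice_qmu.
have norm_le phi : qmu phi ->
    `|den phi s - den phi t| <= logical_dist (@qmu R G) s t.
  move=> phiP; rewrite ler_norml.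
  have := logical_dist_ge PhiP s t phiP; have := logical_dist_ge PhiP t s phiP.
  rewrite [logical_dist _ t s]logical_dist_qmu_sym => ? ?.
  by apply/andP; split; lra.
apply/eqP; rewrite eq_le; apply/andP; split.
  apply: ge_sup; last by move=> _ [phi phiP <-]; exact: norm_le.
  have [[_ [phi phiP _]] _] := has_sup_logical_dist PhiP s t.
  by exists `|den phi s - den phi t|, phi.
apply: (logical_dist_le PhiP) => phi phiP; apply: le_trans (ler_norm _) _.
apply: ub_le_sup; last by exists phi.
by exists (logical_dist (@qmu R G) s t) => _ [psi psiP <-]; exact: norm_le.
Qed.

End LogicalDistance.

Theorem theorem3p11 (R : realType) (G : game R) (s t : state G) :
  sim_metric P1 s t
    = sup [set den phi s - den phi t | phi in @qmu1_pos R G] /\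
  game_bisim_metric s t
    = sup [set `|den phi s - den phi t| | phi in @qmu R G].
Proof.
by rewrite sim_metric_logical bisim_metric_logical sup_norm_logical_dist.
Qed.
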